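(* Let $d\ge 1$ and let $X\subset\mathbb{Z}^d$ be a nonempty supportive set. Then the discrete dimension of $X$ is at least $\log_2(d)-7$, i.e. $$\limsup_{r\to\infty}\frac{\ln|X\cap B_r(0)|}{\ln r}\ \ge\ \log_2(d)-7 .$$
   Context: $e_1,\dots,e_d$ are the standard basis vectors of $\mathbb{Z}^d$. The cross centered at $x\in\mathbb{Z}^d$ is the set $\{x\}\cup\{x+e_i,x-e_i: 1\le i\le d\}$. A set $X\subset\mathbb{Z}^d$ is called supportive if no cross intersects $X$ only by one of the points $x\pm e_i$; that is, there is no $x\in\mathbb{Z}^d$ for which the intersection of $X$ with the cross centered at $x$ is a single point of the form $x+e_i$ or $x-e_i$. The discrete dimension of a set $X\subset\mathbb{Z}^d$ is $\limsup_{r\to\infty}\frac{\ln|X\cap B_r(0)|}{\ln r}$, where $B_r(0)$ is the ball of radius $r$ centered at $0$ (the choice of norm does not affect this value). *)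

(* Defs.v *)
From HB Require Import structures.
From mathcomp Require Import all_boot all_order all_algebra.
From mathcomp Require Import finmap.
From mathcomp Require Import all_classical all_reals all_analysis.

Set Implicit Arguments.
Unset Strict Implicit.
Unset Printing Implicit Defensive.

Import Order.TTheory GRing.Theory Num.Theory.
Import numFieldNormedType.Exports.

Local Open Scope classical_set_scope.
Local Open Scope ring_scope.

Definition stdvec (d : nat) (i : 'I_d) : 'rV[int]_d := delta_mx 0 i.

Definition arms (d : nat) (x : 'rV[int]_d) : set 'rV[int]_d :=
  [set y | exists i : 'I_d, y = x + stdvec i \/ y = x - stdvec i].

Definition cross (d : nat) (x : 'rV[int]_d) : set 'rV[int]_d :=
  [set x] `|` arms x.

Definition supportive (d : nat) (X : set 'rV[int]_d) : Prop :=
  ~ exists x y : 'rV[int]_d, arms x y /\ X `&` cross x = [set y].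

(* The norm on row vectors is the sup norm. *)
Definition lattice_ball (R : realType) (d : nat) (r : R) : set 'rV[int]_d :=
  [set x | (`|x| : int)%:~R <= r].

(* [fset_set] sends infinite sets to [fset0], but lattice balls are finite, so
   the cardinality below is the actual one. *)
Definition discrete_dim (R : realType) (d : nat) (X : set 'rV[int]_d) : \bar R :=
  limf_esup
    (fun r : R => (ln (#|` fset_set (X `&` @lattice_ball R d r)|%fset%:R : R)
                     / ln r)%:E)
    +oo_R.

Definition log2 (R : realType) (x : R) : R := ln x / ln 2.

(* Main.v *)
Require Import Defs.
From HB Require Import structures.
From mathcomp Require Import all_boot all_order all_algebra.
From mathcomp Require Import finmap.
From mathcomp Require Import all_classical all_reals all_analysis.
From mathcomp Require Import zify ring lra.

Import Order.TTheory GRing.Theory Num.Theory.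
Import numFieldNormedType.Exports.

Local Open Scope classical_set_scope.
Local Open Scope ring_scope.

(** From a point of a supportive set X one can always move on in X: if y is in X
    and e_i is a basis vector, the cross centered at y + e_i meets X in a second
    point, which is y + e_i, y + 2e_i or y + e_i +- e_j.  Iterating this
    ([supportive_walk]) gives, for each direction i and each n, a point z of X
    such that z - y has i-th coordinate n or n + 1, while the absolute values of
    the other coordinates add up to no more than the i-th coordinate.

    Fix such a jump for every starting point, direction and length, and compose k
    jumps of the decreasing lengths Q_(k-1), ..., Q_0, where Q_j = 2^(j+1) - 1, in
    arbitrary directions.  There are d^k choices of directions, and every end
    point lies in X within sup distance 2^(k+1) of the start.  Doubling the radius
    thus multiplies the number of choices by d, and it remains to see that a
    point is reached at most C^k times for a suitable constant C.

    When there is one more jump, the jump in direction i only matters if the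
    target v (relative to the start) has v_i > 0; since the coordinates of v have
    bounded sum at the scale of the jump, few of them can be large.  Many of them
    can be small, however, so counting the useful directions is not enough.  The
    remedy is to bound the multiplicity of v by a constant to the power k times
    the distance from v to the boundary of the region that the walks can reach,
      weight v = min (Q_k - |v|_oo, 2 Q_k - |v|_1)   (0 if this is negative).
    After a jump of length Q in a direction with v_i small, the target is almost
    at sup distance Q from the new start, and its weight there is at most v_i; the
    sum of these weights over i is controlled by |v|_1.  If v itself is near the
    boundary, the useful directions are few, or their v_i have a small sum.  This
    is the content of [one_scale]: summed over the d directions, the weights at
    scale Q are at most 12 times the weight at scale 2Q + 1.

    The multiplicities are therefore at most 12^k 2^(k+1) <= 2^(5k+1), so that X
    has at least d^k / 2^(5k+1) points in a ball of radius 2^(k+2)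
    ([supportive_card]).  This gives dimension at least log_2 d - 5 up to terms
    vanishing as k grows, and the difference to log_2 d - 7 absorbs these as soon
    as 2^k >= d. *)

(** * Norms on the integer lattice *)

Definition sup_norm {d : nat} (v : 'rV[int]_d) : nat :=
  (\max_j `|v 0%R j|)%N.

(** The l1 norm of the coordinates outside s.  The estimates below single out one
    or two coordinates of a vector and treat the others together. *)
Definition l1_off {d : nat} (s : seq 'I_d) (v : 'rV[int]_d) : nat :=
  (\sum_(j | j \notin s) `|v 0%R j|)%N.

Notation l1_norm v := (l1_off [::] v).

Lemma coordB {d} (v z : 'rV[int]_d) (j : 'I_d) :
  (v - z) 0 j = (v 0 j : int) - (z 0 j : int).
Proof. by rewrite !mxE. Qed.

Lemma coordD {d} (v z : 'rV[int]_d) (j : 'I_d) :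
  (v + z) 0 j = (v 0 j : int) + (z 0 j : int).
Proof. by rewrite !mxE. Qed.

Lemma abs_le_sup_norm {d} (v : 'rV[int]_d) (j : 'I_d) :
  (`|v 0%R j| <= sup_norm v)%N.
Proof. exact: (@bigop.leq_bigmax _ (fun j => absz (v 0%R j))). Qed.

Lemma sup_norm_le {d} (v : 'rV[int]_d) m :
  (forall j, (`|v 0%R j| <= m)%N) -> (sup_norm v <= m)%N.
Proof. by move=> h; apply/bigmax_leqP => j _. Qed.

Lemma sup_norm_attained {d} (v : 'rV[int]_d) (i0 : 'I_d) :
  exists p : 'I_d, sup_norm v = `|v 0%R p|%N.
Proof.
have hc : (0 < #|'I_d|)%N by rewrite card_ord; case: d i0 {v} => // -[].
by have [p hp] := bigop.eq_bigmax (fun j => absz (v 0%R j)) hc; exists p.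
Qed.

Lemma sup_norm_triangle {d} (u w : 'rV[int]_d) :
  (sup_norm (u + w)%R <= sup_norm u + sup_norm w)%N.
Proof.
apply: sup_norm_le => j; have := abs_le_sup_norm u j.
have := abs_le_sup_norm w j; rewrite coordD; lia.
Qed.

Lemma l1_off_cons {d} (v : 'rV[int]_d) (s : seq 'I_d) (i : 'I_d) : i \notin s ->
  l1_off s v = (`|v 0%R i| + l1_off (i :: s) v)%N.
Proof.
move=> si; rewrite /l1_off (bigD1 i) //=; congr (_ + _)%N.
by apply: eq_bigl => j; rewrite in_cons negb_or andbC.
Qed.

Lemma l1_off_pairC {d} (v : 'rV[int]_d) (i p : 'I_d) :
  l1_off [:: i; p] v = l1_off [:: p; i] v.
Proof. by apply: eq_bigl => j; rewrite !inE orbC. Qed.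

Lemma l1_off_triangle {d} (s : seq 'I_d) (u w : 'rV[int]_d) :
  (l1_off s (u + w)%R <= l1_off s u + l1_off s w)%N.
Proof.
by rewrite -big_split /=; apply: leq_sum => j _; rewrite coordD; lia.
Qed.

Lemma l1_offN {d} (s : seq 'I_d) (v : 'rV[int]_d) : l1_off s (- v)%R = l1_off s v.
Proof. by apply: eq_bigr => j _; rewrite mxE abszN. Qed.

Lemma l1_off_stdvec {d} (s : seq 'I_d) (j : 'I_d) :
  (l1_off s (stdvec j) <= (j \notin s))%N.
Proof.
have zero k : k != j -> `|stdvec j 0%R k|%N = 0%N.
  by move=> /negPf kj; rewrite mxE kj.
have [js|js] /= := boolP (j \in s).
  by rewrite leqn0 /l1_off big1 // => k ks; apply: zero; apply: contraNneq ks => ->.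
rewrite (l1_off_cons _ s j js) mxE !eqxx /l1_off big1 // => k.
by rewrite in_cons negb_or => /andP[/zero].
Qed.

(** * Walking inside a supportive set *)

(** The displacements that arise from walking in direction i until the i-th
    coordinate has grown by n. *)
Definition in_cone {d : nat} (i : 'I_d) (n : nat) (z : 'rV[int]_d) : Prop :=
  [/\ n%:Z <= z 0 i, z 0 i <= n.+1%:Z & (l1_off [:: i] z)%:Z <= z 0 i].

(** The neighbor x = y + e_i has y in its cross, as an arm; supportiveness yields
    another point z of X there.  If z = x - e_j, then j <> i because z <> y, so
    the coordinate i still increases by one. *)
Lemma supportive_step {d} {X : set 'rV[int]_d} (hX : supportive X) y i :
  X y -> exists2 z, X z & in_cone i 1 (z - y).
Proof.
move=> Xy; pose x := y + stdvec i.
have yx : arms x y by exists i; right; rewrite addrK.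
have [z [[Xz xz] zy]] : exists z, (X `&` cross x) z /\ z <> y.
  apply: contrapT => no; apply: hX; exists x, y; split=> //.
  apply/seteqP; split=> [z hz|z ->]; last by split=> //; right.
  by apply: contrapT => zy; apply: no; exists z.
exists z => //.
have ii : (stdvec i 0 i : int) = 1 by rewrite mxE !eqxx.
have offi : l1_off [:: i] (stdvec i) = 0%N.
  by apply/eqP; rewrite -leqn0 (leq_trans (l1_off_stdvec _ _)) // inE eqxx.
have coordj (j : 'I_d) : (stdvec j 0 i : int) = (j == i)%:R.
  by rewrite mxE eqxx eq_sym.
case: xz => [->|[j [->|ze]]].
- have -> : x - y = stdvec i by rewrite /x addrC addKr.
  by rewrite /in_cone ii offi.
- have -> : x + stdvec j - y = stdvec i + stdvec j.
    by rewrite /x -[y + _ + _]addrA [LHS]addrC addKr.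
  have := l1_off_triangle [:: i] (stdvec i) (stdvec j).
  have := l1_off_stdvec [:: i] j.
  rewrite /in_cone !coordD ii offi coordj inE.
  by case: (j == i) => /=; split; lia.
- have ji : (j == i) = false.
    by apply/eqP => ji; apply: zy; rewrite ze ji /x addrK.
  have -> : z - y = stdvec i - stdvec j.
    by rewrite ze /x addrAC [y + _]addrC addrK.
  have := l1_off_triangle [:: i] (stdvec i) (- stdvec j).
  have := l1_off_stdvec [:: i] j.
  rewrite /in_cone !coordB l1_offN ii offi coordj inE ji.
  by split; lia.
Qed.

(** The cone conditions add up; only the upper bound n + 2 on the coordinate i needs
    that u has exactly reached n, as a step may increase this coordinate by 2. *)
Lemma in_cone_succ {d} (i : 'I_d) n (u w : 'rV[int]_d) :
  u 0 i = n%:Z -> in_cone i n u -> in_cone i 1 w -> in_cone i n.+1 (u + w).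
Proof.
move=> un [u1 u2 u3] [w1 w2 w3]; rewrite /in_cone !coordD.
by have := l1_off_triangle [:: i] u w; split; lia.
Qed.

Lemma supportive_walk {d} {X : set 'rV[int]_d} (hX : supportive X) y i n :
  X y -> exists2 z, X z & in_cone i n (z - y).
Proof.
move=> Xy; elim: n => [|n [z Xz hz]].
  exists y => //; rewrite subrr /in_cone mxE.
  by rewrite /l1_off big1 // => j _; rewrite mxE.
set u : 'rV[int]_d := z - y in hz.
(* A walk that has overshot to n + 1 waits for one turn. *)
have [un|un] := eqVneq (u 0 i : int) n%:Z; last first.
  exists z => //; rewrite -/u; move: un hz; rewrite neq_lt => un [h1 h2 h3].
  by split; lia.
have [w Xw hw] := supportive_step hX z i Xz.
by exists w => //; rewrite -(subrKA z) addrC; exact: in_cone_succ un hz hw.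
Qed.

(** * The one-scale inequality *)

(** A measure of how far v lies inside the region of sup norm less than Q and l1
    norm less than 2Q.  When Q + 1 is a power of 2, this region contains all that
    jumps of lengths (Q - 1)/2, (Q - 3)/4, ..., 1 can reach.  The subtractions are
    truncated, so that the weight is 0 exactly outside this region. *)
Definition weight {d : nat} (Q : nat) (v : 'rV[int]_d) : nat :=
  minn (Q - sup_norm v) (Q.*2 - l1_norm v).

Section Contribution.
Context {d Q : nat} {i : 'I_d} {v z : 'rV[int]_d}.
Hypothesis hz : in_cone i Q z.

(** A jump of length Q has sup norm at most Q + 1 and l1 norm at most 2(Q + 1), which
    is what both bounds lose when 2Q + 1 is replaced by Q. *)
Lemma weight_mono : (weight Q (v - z)%R <= weight Q.*2.+1 v)%N.
Proof.
case: hz => h1 h2 h3.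
have z_sup : (sup_norm z <= Q.+1)%N.
  apply: sup_norm_le => j.
  have [->|ji] := eqVneq j i; first lia.
  by move: h3; rewrite (l1_off_cons _ _ j) ?inE //; lia.
have z_l1 : (l1_norm z <= Q.+1.*2)%N by rewrite (l1_off_cons _ _ i) //; lia.
have := sup_norm_triangle (v - z) z; have := l1_off_triangle [::] (v - z) z.
rewrite subrK /weight; lia.
Qed.

(** The jump goes at least Q far in direction i, so only |v_i| is left of Q. *)
Lemma weight_le_coord : (weight Q (v - z)%R <= `|v 0%R i|)%N.
Proof.
case: hz => h1 h2 h3; have := abs_le_sup_norm (v - z) i.
rewrite /weight coordB; lia.
Qed.

(** If the l1 norm of v is within a small b of its bound, a useful jump must decrease
    it by nearly the whole l1 norm of the jump, hence go straight towards v and not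
    overshoot: v_i is at least Q - b/2. *)
Lemma weight_l1_bound : (0 < weight Q (v - z)%R)%N ->
  (Q.*2 <= 2 * `|v 0%R i| + (Q.*2.+1.*2 - l1_norm v))%N.
Proof.
case: hz => h1 h2 h3; have := abs_le_sup_norm (v - z) i.
have := l1_off_triangle [:: i] (v - z) z; rewrite subrK.
rewrite /weight !(l1_off_cons _ [::] i) // coordB; lia.
Qed.

(** Suppose that |v_p| is within a small a of its bound.  A useful jump in a direction i <> p
    must then also move by nearly Q along p, and its l1 norm is used up by i and p.
    The remaining vector has entries close to Q at p and, in absolute value, to
    Q - v_i at i, and little of the bound 2Q on its l1 norm is left for the others.
    So the sum of |v_j| over all j <> p cannot be much larger than v_i. *)
Lemma weight_sup_bound (p : 'I_d) : p != i -> sup_norm v = `|v 0%R p|%N ->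
  (0 < weight Q (v - z)%R)%N ->
  (l1_off [:: p] v <= 2 * (Q.*2.+1 - sup_norm v) + 2 * `|v 0%R i|)%N.
Proof.
move=> pi hp; case: hz => h1 h2 h3.
have := abs_le_sup_norm (v - z) i; have := abs_le_sup_norm (v - z) p.
have := l1_off_triangle [:: p; i] (v - z) z; rewrite subrK.
rewrite /weight hp (l1_off_cons _ [::] i) // (l1_off_cons (v - z) [:: i] p) ?inE //.
rewrite (l1_off_cons v [:: p] i) ?inE 1?eq_sym // l1_off_pairC.
by move: h3; rewrite (l1_off_cons z [:: i] p) ?inE // !coordB; lia.
Qed.

End Contribution.

(** Every term is at most e := weight v and at most |v_i|.  It remains to show that
    the terms that are not small compared with |v_i| are few.  This depends on
    which of the two bounds defines e: when it is the sup norm, terms with i <> p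
    vanish unless |v_i| is a fixed fraction of the sum S of all |v_j|, j <> p (or S
    is itself at most 4e); when it is the l1 norm, they vanish unless |v_i| is at
    least Q/2 (or Q is less than e). *)
Lemma one_scale {d Q} (v : 'rV[int]_d) (z : 'I_d -> 'rV[int]_d) :
  (0 < Q)%N -> (forall i, in_cone i Q (z i)) ->
  (\sum_i weight Q (v - z i)%R <= 12 * weight Q.*2.+1 v)%N.
Proof.
move=> Q0 hz.
have [w0|w_gt0] := posnP (weight Q.*2.+1 v).
  by rewrite big1 // => i _; have := weight_mono (v := v) (hz i); lia.
set e := weight _ v in w_gt0 *.
have le_e i : (weight Q (v - z i)%R <= e)%N by exact: weight_mono (hz i).
have [eA|eB] : e = (Q.*2.+1 - sup_norm v)%N \/ e = (Q.*2.+1.*2 - l1_norm v)%N.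
  by rewrite /e /weight; lia.
- have [i0|no_i] := pickP 'I_d; last by rewrite big_pred0.
  move=> _; have [p hp] := sup_norm_attained v i0.
  set S := l1_off [:: p] v.
  rewrite (bigD1 p) //=.
  suff h : (\sum_(i | i != p) weight Q (v - z i)%R <= 4 * e)%N.
    by apply: leq_trans (leq_add (le_e p) h) _; lia.
  have sumS : (\sum_(i < d | i != p) `|v 0%R i| = S)%N.
    by apply: eq_bigl => i; rewrite inE.
  have [S4|S4] := leqP S (4 * e).
    apply: leq_trans S4; rewrite -sumS; apply: leq_sum => i _.
    exact: weight_le_coord (hz i).
  have S_gt0 : (0 < S)%N by lia.
  (* Here a nonzero term has S <= 4 |v_i|, and S times it is at most 4e |v_i|. *)
  rewrite -(leq_pmul2l S_gt0) big_distrr /=.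
  apply: (@leq_trans (\sum_(i < d | i != p) (4 * e) * `|v 0%R i|)%N); last first.
    by rewrite -big_distrr /= sumS mulnC.
  apply: leq_sum => i ip.
  have [->|g0] := posnP (weight Q (v - z i)%R); first by rewrite muln0.
  have pi : p != i by rewrite eq_sym.
  have := weight_sup_bound (hz i) p pi hp g0; rewrite -/S -eA.
  have := le_e i; nia.
- have l1_le : (\sum_i weight Q (v - z i)%R <= l1_norm v)%N.
    by apply: leq_sum => i _; exact: weight_le_coord (hz i).
  have [Qe|eQ] := ltnP Q e; first lia.
  (* Here a nonzero term has Q <= 2 |v_i|, and Q times it is at most 2e |v_i|. *)
  rewrite -(leq_pmul2l Q0) big_distrr /=.
  apply: (@leq_trans (\sum_(i < d) (2 * e) * `|v 0%R i|)%N).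
    apply: leq_sum => i _.
    have [->|g0] := posnP (weight Q (v - z i)%R); first by rewrite muln0.
    have := weight_l1_bound (hz i) g0; rewrite -eB.
    have := le_e i; nia.
  rewrite -big_distrr /=.
  have -> : (\sum_(i < d) `|v 0%R i| = l1_norm v)%N by [].
  have : (l1_norm v <= 6 * Q)%N by lia.
  nia.
Qed.

(** * Many points at the end of multiscale walks *)

(** Chosen so that all walks with jumps of length scale (k-1), ..., scale 0, which
    may each be exceeded by one, stay at sup distance less than scale k; this is
    the recursion [scaleS]. *)
Definition scale (k : nat) : nat := (2 ^ k.+1).-1.

Lemma scaleS k : scale k.+1 = (scale k).*2.+1.
Proof. by rewrite /scale expnS; have := expn_gt0 2 k.+1; lia. Qed.

Lemma scale_gt0 k : (0 < scale k)%N.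
Proof. by elim: k => // k; rewrite scaleS. Qed.

(** Endpoints of the walks with jumps of length scale (k-1), ..., scale 0 from y,
    one for each choice of the directions: the multiplicities in this sequence
    matter. *)
Fixpoint descendants {d : nat} (jump : nat -> 'I_d -> 'rV[int]_d -> 'rV[int]_d)
    (k : nat) (y : 'rV[int]_d) : seq 'rV[int]_d :=
  if k is k'.+1 then
    flatten [seq descendants jump k' (jump (scale k') i y) | i <- enum 'I_d]
  else [:: y].

Lemma descendantsS {d} (jump : nat -> 'I_d -> 'rV[int]_d -> 'rV[int]_d) k y :
  descendants jump k.+1 y =
  flatten [seq descendants jump k (jump (scale k) i y) | i <- enum 'I_d].
Proof. by []. Qed.

Section Descendants.
Context {d : nat} {X : set 'rV[int]_d}.
Context {jump : nat -> 'I_d -> 'rV[int]_d -> 'rV[int]_d}.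
Hypothesis jumpX : forall n i y, X y -> X (jump n i y).
Hypothesis jump_cone : forall n i y, X y -> in_cone i n (jump n i y - y).

Lemma size_descendants k y : size (descendants jump k y) = (d ^ k)%N.
Proof.
elim: k y => // k IH y.
rewrite descendantsS size_flatten sumnE 2!big_map big_enum /=.
by under eq_bigr do rewrite IH; rewrite sum_nat_const card_ord expnS.
Qed.

Lemma descendantsX k y w : X y -> w \in descendants jump k y -> X w.
Proof.
elim: k y => [|k IH] y Xy; first by rewrite inE => /eqP ->.
by rewrite descendantsS => /flatten_mapP[i _]; apply: IH; exact: jumpX.
Qed.

(** The directions of a walk can be recovered from its endpoint up to 12^k times the
    weight: induction on the number of jumps, splitting off the longest one. *)
Lemma count_descendants k y w : X y ->
  (count_mem w (descendants jump k y) <= 12 ^ k * weight (scale k) (w - y)%R)%N.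
Proof.
elim: k y => [|k IH] y Xy.
  rewrite /= addn0 mul1n; case: eqVneq => //= ->; rewrite subrr.
  have -> : weight (scale 0) (0 : 'rV[int]_d) = 1%N; last by [].
  have s0 : (sup_norm (0 : 'rV[int]_d) <= 0)%N.
    by apply: sup_norm_le => j; rewrite mxE.
  have l0 : l1_norm (0 : 'rV[int]_d) = 0%N.
    by rewrite /l1_off big1 // => j _; rewrite mxE.
  by rewrite /weight l0 /scale; move: s0; lia.
rewrite descendantsS count_flatten sumnE 2!big_map big_enum /=.
apply: (@leq_trans (\sum_(i < d) 12 ^ k *
    weight (scale k) ((w - y) - (jump (scale k) i y - y))%R)%N).
  apply: leq_sum => i _; rewrite opprB addrA subrK.
  exact: IH (jumpX _ _ _ Xy).
rewrite -big_distrr /= expnSr -mulnA leq_pmul2l ?expn_gt0 // scaleS.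
by apply: one_scale (scale_gt0 k) _ => i; exact: jump_cone.
Qed.

(** A point outside the region where the weight is positive has multiplicity 0. *)
Lemma sup_norm_descendants k y w : X y -> w \in descendants jump k y ->
  (sup_norm w <= 2 ^ k.+1 + sup_norm y)%N.
Proof.
move=> Xy; rewrite -has_pred1 has_count => h.
have := leq_trans h (count_descendants k _ _ Xy).
rewrite muln_gt0 => /andP[_]; have := sup_norm_triangle (w - y) y.
by rewrite subrK /weight /scale; lia.
Qed.

End Descendants.

Lemma size_le_undup {T : eqType} (s : seq T) m :
  (forall x, (count_mem x s <= m)%N) -> (size s <= size (undup s) * m)%N.
Proof.
move=> h; rewrite -(perm_size (perm_count_undup s)) size_flatten sumnE !big_map.
under eq_bigr do rewrite size_nseq.
apply: (@leq_trans (\sum_(x <- undup s) m)%N); first exact: leq_sum.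
by rewrite big_const_seq count_predT iter_addn_0 mulnC.
Qed.

(** * Counting in balls *)

Lemma mx_norm_sup_norm {d} (x : 'rV[int]_d) : (`|x| : int) = (sup_norm x)%:Z.
Proof.
apply/eqP; rewrite eq_le; apply/andP; split; rewrite /Num.norm /= mx_normrE.
  apply: bigmax_le => // -[i j] _ /=; rewrite (ord1 i).
  by have := abs_le_sup_norm x j; lia.
suff h (j : 'I_d) : (absz (x 0 j))%:Z <= \big[Num.max/0]_ij `|x ij.1 ij.2|.
  have [d0|i0] := posnP d; last first.
    by have [p ->] := sup_norm_attained x (Ordinal i0).
  have -> : sup_norm x = 0%N.
    by apply/eqP; rewrite -leqn0; apply: sup_norm_le => j; have := ltn_ord j; lia.
  exact: bigmax_ge_id.
have := le_bigmax (0 : int) (fun ij : 'I_1 * 'I_d => `|x ij.1 ij.2|) (0, j).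
by apply: le_trans => /=; lia.
Qed.

(** As [fset_set] sends infinite sets to the empty one, counting the points of X in a
    ball relies on this. *)
Lemma finite_lattice_ball {R : realType} {d} (r : R) :
  finite_set (@lattice_ball R d r).
Proof.
pose m := Num.bound `|r|.
pose f (g : {ffun 'I_d -> 'I_(m + m).+1}) : 'rV[int]_d :=
  \row_j ((g j : nat)%:Z - m%:Z).
apply: (@sub_finite_set _ _ (range f)); last first.
  by apply: finite_image; exact: finite_finset.
move=> x; rewrite /lattice_ball /= mx_norm_sup_norm => xr.
have xm : (sup_norm x <= m)%N.
  rewrite -(ler_nat R); apply: le_trans xr _.
  by apply: le_trans (ler_norm r) _; apply/ltW/archi_boundP.
exists [ffun j => inord (absz (x 0 j + m%:Z))] => //.
apply/rowP => j; rewrite mxE ffunE.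
have := abs_le_sup_norm x j => xj.
by rewrite inordK; lia.
Qed.

(** The quantitative form of the theorem: d^k walks, each endpoint being shared by at
    most 16^k 2^(k+1) of them. *)
Lemma supportive_card (R : realType) {d} {X : set 'rV[int]_d} (y : 'rV[int]_d)
    (k : nat) :
  supportive X -> X y -> (sup_norm y <= 2 ^ k.+1)%N ->
  (d ^ k <= #|` fset_set (X `&` @lattice_ball R d (2 ^+ k.+2))|%fset
            * 2 ^ (5 * k).+1)%N.
Proof.
move=> hX Xy yk.
have /choice[j hj] (t : nat * 'I_d * 'rV[int]_d) : exists z,
    X t.2 -> X z /\ in_cone t.1.2 t.1.1 (z - t.2).
  have [Xt|nX] := pselect (X t.2); last by exists 0.
  by have [z Xz hz] := supportive_walk hX _ t.1.2 t.1.1 Xt; exists z.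
pose jump n i z := j (n, i, z).
have jumpX n i z : X z -> X (jump n i z) by move=> /(hj (n, i, z))[].
have jump_cone n i z : X z -> in_cone i n (jump n i z - z).
  by move=> /(hj (n, i, z))[].
set s := descendants jump k y.
have mult x : (count_mem x s <= 2 ^ (5 * k).+1)%N.
  apply: leq_trans (count_descendants jumpX jump_cone k _ _ Xy) _.
  have -> : (2 ^ (5 * k).+1 = 16 ^ k * 2 ^ k.+1)%N.
    by rewrite -[16%N]/(2 ^ 4)%N -expnM -expnD; congr (_ ^ _)%N; lia.
  apply: leq_mul; first by case: (k) => // k'; rewrite leq_exp2r.
  by rewrite /weight /scale; lia.
rewrite -(size_descendants (jump := jump) k y) -/s.
apply: leq_trans (size_le_undup s _ mult) _.
rewrite leq_mul2r; apply/orP; right.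
apply: uniq_leq_size (undup_uniq s) _ => w; rewrite mem_undup => ws.
rewrite in_fset_set; last first.
  exact: sub_finite_set (@subIsetr _ _ _) (finite_lattice_ball _).
rewrite inE; split; first exact: (descendantsX jumpX _ _ _ Xy ws).
rewrite /lattice_ball /= mx_norm_sup_norm.
have := sup_norm_descendants jumpX jump_cone k _ _ Xy ws => wk.
rewrite -[X in _ <= X]natrX ler_nat.
by rewrite expnS; lia.
Qed.

Theorem theorem4p1 (R : realType) (d : nat) (hd : (1 <= d)%N)
    (X : set 'rV[int]_d) (X0 : X !=set0) (hX : supportive X) :
  ((log2 (d%:R : R) - 7)%:E <= discrete_dim R X)%E.
Proof.
case: X0 => y Xy.
apply: le_ereal_inf_tmp => _ [V [M [_ MV]] <-].
(* It suffices to find one radius beyond M at which the quotient is large enough. *)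
have [k kpow [d_le y_le M_le]] : exists2 k, (k < 2 ^ k)%N &
    [/\ d <= k, sup_norm y <= k & Num.bound `|M| <= k]%N.
  exists (maxn d (maxn (sup_norm y) (Num.bound `|M|))); first exact: ltn_expl.
  by rewrite !leq_max !leqnn !orbT.
have yk : (sup_norm y <= 2 ^ k.+1)%N.
  apply: leq_trans y_le (leq_trans (ltnW kpow) _).
  by rewrite leq_exp2l.
have := supportive_card R y k hX Xy yk.
set N := size _ => card.
apply: (@le_trans _ _ (ln (N%:R : R) / ln (2 ^+ k.+2 : R))%:E); last first.
  apply: ereal_sup_ubound; exists (2 ^+ k.+2) => //; apply: MV.
  apply: le_lt_trans (ler_norm M) _; apply: lt_trans (archi_boundP _) _ => //.
  rewrite -natrX ltr_nat; apply: leq_ltn_trans M_le (ltn_trans kpow _).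
  by rewrite ltn_exp2l.
rewrite lee_fin /log2.
set L := ln (2 : R); set D := ln (d%:R : R).
have L_gt0 : 0 < L by rewrite ln_gt0 // ltr1n.
have dk : D <= k%:R * L.
  rewrite mulr_natl -lnXn // ler_ln ?posrE ?exprn_gt0 ?ltr0n //.
  by rewrite -natrX ler_nat (leq_trans d_le (ltnW kpow)).
have N_gt0 : (0 < N)%N.
  by case: (posnP N) card => // ->; rewrite mul0n leqNgt expn_gt0 hd.
have cardln : k%:R * D <= ln (N%:R : R) + (5 * k).+1%:R * L.
  rewrite !mulr_natl -!lnXn ?ltr0n // -lnM ?posrE ?exprn_gt0 ?ltr0n //.
  rewrite ler_ln ?posrE ?mulr_gt0 ?exprn_gt0 ?ltr0n //.
  by rewrite -!natrX -natrM ler_nat.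
rewrite lnXn // -/L -[L *+ _]mulr_natl ler_pdivlMr ?mulr_gt0 //.
have -> : (D / L - 7) * (k.+2%:R * L) = (D - 7 * L) * k.+2%:R.
  by field; rewrite gt_eqF.
have -> : k.+2%:R = k%:R + 2 :> R by rewrite -addn2 natrD.
have e : (5 * k).+1%:R = 5 * k%:R + 1 :> R by rewrite -addn1 natrD natrM.
rewrite e in cardln.
have k_ge0 : 0 <= (k%:R : R) by rewrite ler0n.
nra.
Qed.
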